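(* Let $n\ge 1$ be an integer, let $i_1,\dots,i_n$ be independent real random variables with $E(1+i_l)=1+j$ and $Var(1+i_l)=s^2$ for every $l$, where $j\in\mathbb{R}\setminus\{0,-1\}$, and let $1\le k\le n$. Let $C_k$ be the final value of the increasing annuity-due with $k$ annual payments $1,2,\dots,k$, and let $\mu_l=E(C_l)$, $m_k=E(C_k^2)$, $m=1+f$, $M_{1k}=\sum_{l=1}^{k} l^2 m^{k+1-l}$ and $M_{2k}=\sum_{l=1}^{k-1}(l+1)m^{k-l}\mu_l$. Then (a) $E(C_k)=(I\ddot s)_{\overline{k}|j}$; (b) $M_{1k}=(I^2\ddot s)_{\overline{k}|f}$; (c) $M_{2k}=\dfrac{(1+j)^{k+2}(I\ddot s)_{\overline{k}|r}-(1+j)(I\ddot s)_{\overline{k}|f}-j(1+j)(I^2\ddot s)_{\overline{k}|f}}{j^2}$; (d) $m_k=\dfrac{2(1+j)^{k+2}(I\ddot s)_{\overline{k}|r}-2(1+j)(I\ddot s)_{\overline{k}|f}-j(2+j)(I^2\ddot s)_{\overline{k}|f}}{j^2}$.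
   Context: Final value: for annual payments $c_1,c_2,\dots$ the final value is defined by $C_1=(1+i_1)c_1$ and $C_k=(1+i_k)(C_{k-1}+c_k)$ for $k\ge 2$; here $c_l=l$. For a positive integer $k$ and real $x$: $(I\ddot s)_{\overline{k}|x}=\sum_{l=1}^k l(1+x)^{k+1-l}$, $(I^2\ddot s)_{\overline{k}|x}=\sum_{l=1}^k l^2(1+x)^{k+1-l}$. Constants: $f=2j+j^2+s^2$ (so $m=1+f=E[(1+i_l)^2]$), and $r$ is defined by $1+r=(1+f)/(1+j)$. An empty sum is $0$. *)

(* Defs.v *)
From HB Require Import structures.
From mathcomp Require Import all_boot all_order all_algebra.
From mathcomp Require Import all_classical all_reals all_analysis.

Set Implicit Arguments.
Unset Strict Implicit.
Unset Printing Implicit Defensive.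

Import Order.TTheory GRing.Theory Num.Theory.

Local Open Scope classical_set_scope.
Local Open Scope ring_scope.

(* Mutual independence of a finite family of random variables: the product
   rule for every subfamily J and all measurable sets B_l, l in J. *)
Definition mutually_independent (R : realType) (d d' : measure_display)
    (T : measurableType d) (T' : measurableType d') (P : probability T R)
    (I : finType) (X : I -> {RV P >-> T'}) : Prop :=
  forall (J : {set I}) (B : I -> set T'),
    (forall l, l \in J -> measurable (B l)) ->
    P (\bigcap_(l in [set` J]) (X l @^-1` B l)) =
    (\prod_(l in J) P (X l @^-1` B l))%E.

(* Annual payments c_1, c_2, ... and annual rates i_1, i_2, ... are indexed
   from 1; the value at k = 0 is a dummy. *)
Fixpoint final_value (R : pzRingType) (i c : nat -> R) (k : nat) : R :=
  match k with
  | 0 => 0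
  | 1 => (1 + i 1%N) * c 1%N
  | (_.+1 as k').+1 => (1 + i k'.+1) * (final_value i c k' + c k'.+1)
  end.

Definition increasing_final_value (R : pzRingType) (i : nat -> R) (k : nat) : R :=
  final_value i (fun l => l%:R) k.

(* (I s-double-dot)_{k|x} *)
Definition Is_due (R : pzRingType) (k : nat) (x : R) : R :=
  \sum_(1 <= l < k.+1) l%:R * (1 + x) ^+ (k.+1 - l).

(* (I^2 s-double-dot)_{k|x} *)
Definition I2s_due (R : pzRingType) (k : nat) (x : R) : R :=
  \sum_(1 <= l < k.+1) l%:R ^+ 2 * (1 + x) ^+ (k.+1 - l).

(* Main.v *)
(* [C_k] is a function of [i_1, ..., i_k], hence independent of [i_(k+1)] by the
   pi-lambda theorem applied to the rectangles in [i_1, ..., i_k]. In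
   [C_(k+1) = (1 + i_(k+1)) (C_k + k + 1)] the first and second moments of the
   two factors therefore multiply, which gives linear recursions for [E(C_k)]
   and [E(C_k^2)]. The latter is solved by [M1 + 2 M2], and [M2] is evaluated by
   inserting the closed form
   [j^2 E(C_l) = (1+j)^(l+2) - (1+j) - j (1+j) (l+1)]; its geometric term
   is what produces the rate [r]. *)
Require Import Defs.
From HB Require Import structures.
From mathcomp Require Import all_boot all_order all_algebra.
From mathcomp Require Import all_classical all_reals all_analysis.
From mathcomp Require Import measurable_realfun ring.

Set Implicit Arguments.
Unset Strict Implicit.
Unset Printing Implicit Defensive.

Import Order.TTheory GRing.Theory Num.Theory.

Local Open Scope classical_set_scope.
Local Open Scope ring_scope.

(** * Expectations, and products of two independent variables *)

Definition has_expectation (R : realType) (d : measure_display)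
    (T : measurableType d) (P : probability T R) (X : T -> R) (c : R) : Prop :=
  P.-integrable [set: T] (EFin \o X) /\ ('E_P[X] = c%:E)%E.

Definition independent2 (R : realType) (d : measure_display)
    (T : measurableType d) (P : probability T R) (X Y : T -> R) : Prop :=
  forall A B : set R, measurable A -> measurable B ->
    P (X @^-1` A `&` Y @^-1` B) = (P (X @^-1` A) * P (Y @^-1` B))%E.

Section Expectation.
Context (R : realType) (d : measure_display) (T : measurableType d)
  (P : probability T R).
Implicit Types (X Y : T -> R) (a b c : R).

(* An infinite positive or negative part makes the integral infinite, because
   [+oo - +oo = -oo] for extended reals. *)
Lemma fin_has_expectation X c : measurable_fun [set: T] X ->
  ('E_P[X] = c%:E)%E -> has_expectation P X c.
Proof.
move=> mX EX; split=> //.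
have mX' : measurable_fun [set: T] (fun w => (X w)%:E) by exact/measurable_EFinP.
have fin : (\int[P]_x (EFin \o X)^\+ x < +oo)%E /\
           (\int[P]_x (EFin \o X)^\- x < +oo)%E.
  have := EX; rewrite unlock integralE.
  have : (0 <= \int[P]_x (EFin \o X)^\+ x)%E by exact: integral_ge0.
  have : (0 <= \int[P]_x (EFin \o X)^\- x)%E by exact: integral_ge0.
  case: (integral _ _ _) => [p| |] //; case: (integral _ _ _) => [q| |] //.
  by rewrite !ltry.
apply/integrableP; split=> //.
rewrite -[X in (integral _ _ X < _)%E]/(abse \o (EFin \o X)) fune_abse.
rewrite ge0_integralD//; last 2 first.
- exact: measurable_funepos.
- exact: measurable_funeneg.
by case: fin => ? ?; rewrite lte_add_pinfty.
Qed.

Lemma has_expectation_cst c : has_expectation P (fun=> c) c.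
Proof.
by split; [exact: finite_measure_integrable_cst|exact: expectation_cst].
Qed.

Lemma has_expectationD X Y a b : has_expectation P X a ->
  has_expectation P Y b -> has_expectation P (fun w => X w + Y w) (a + b).
Proof.
move=> [iX EX] [iY EY]; split.
  by apply: eq_integrable (integrableD measurableT iX iY).
by rewrite expectationD ?EX ?EY//; exact/Lfun1_integrable.
Qed.

Lemma has_expectationZ X a c : has_expectation P X a ->
  has_expectation P (fun w => c * X w) (c * a).
Proof.
move=> [iX EX]; split.
  by apply: eq_integrable (integrableZl measurableT c iX).
have -> : (fun w => c * X w) = c \o* X by apply/funext => w /=; rewrite mulrC.
by rewrite expectationZl ?EX//; exact/Lfun1_integrable.
Qed.

Lemma independent2_comp X Y (g h : R -> R) :
  measurable_fun [set: R] g -> measurable_fun [set: R] h ->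
  independent2 P X Y -> independent2 P (g \o X) (h \o Y).
Proof.
move=> mg mh XY A B mA mB; apply: (XY (g @^-1` A) (h @^-1` B)).
- by rewrite -[X in measurable X]setTI; exact: mg.
- by rewrite -[X in measurable X]setTI; exact: mh.
Qed.

(** Under independence the joint law of [X] and [Y] is the product of their laws. Tonelli gives
    integrability of the product under that law, Fubini factors its mean, and a change of variables
    carries both back to [P]. *)
Lemma has_expectationM (X Y : {RV P >-> R}) a b : independent2 P X Y ->
  has_expectation P X a -> has_expectation P Y b ->
  has_expectation P (fun w => X w * Y w) (a * b).
Proof.
move=> XY [iX EX] [iY EY].
pose F := fun z : R * R => (z.1 * z.2)%:E.
have mF : measurable_fun [set: R * R] F.
  by apply/measurable_EFinP; exact: measurable_funM.
have FE x y : F (x, y) = (x%:E * y%:E)%E by rewrite /F EFinM.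
have mXY : measurable_fun [set: T] (fun w => (X w, Y w)).
  exact: measurable_fun_pair.
pose XYm : {mfun T >-> (R * R)%type} := mfun_Sub (mem_set mXY).
pose muX := distribution P X; pose muY := distribution P Y.
(* Independence is agreement on rectangles, which determines the product measure. *)
have prodE A : measurable A -> (muX \x muY)%E A = distribution P XYm A.
  by move=> mA; apply: product_measure_unique => // B C mB mC; exact: XY.
have mabs : measurable_fun [set: R] (fun x : R => `|x%:E|%E).
  exact: measurableT_comp.
have absX (Z : {RV P >-> R}) : P.-integrable [set: T] (EFin \o Z) ->
    (\int[distribution P Z]_x `|x%:E| < +oo)%E.
  by move=> /integrableP[_ iZ]; rewrite ge0_integral_distribution.
(* The iterated integral of [|x y|] is [E|X| E|Y|], which is finite. *)
have iF : (muX \x muY)%E.-integrable [set: R * R] F.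
  apply/integrable12ltyP => //.
  under eq_integral => x _.
    under eq_integral => y _ do rewrite FE abseM.
    rewrite ge0_integralZl//; [|by []..].
    over.
  rewrite ge0_integralZr//; last exact: integral_ge0.
  apply: lte_mul_pinfty; [exact: integral_ge0| |exact: absX].
  by rewrite ge0_fin_numE ?integral_ge0//; exact: absX.
have iXY : P.-integrable [set: T] (F \o XYm).
  apply/integrableP; split; first exact: measurableT_comp.
  have mabsF : measurable_fun [set: R * R] (abse \o F).
    exact: measurableT_comp.
  rewrite -[ltLHS](ge0_integral_distribution XYm mabsF (fun z => abse_ge0 (F z))).
  have /integrableP[_] := iF.
  by rewrite (eq_measure_integral (distribution P XYm))// => A mA _; exact: prodE.
split=> //.
rewrite unlock.
have meanZ (Z : {RV P >-> R}) z : P.-integrable [set: T] (EFin \o Z) ->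
    ('E_P[Z] = z%:E)%E -> (\int[distribution P Z]_x x%:E = z%:E)%E.
  by move=> iZ <-; rewrite integral_distribution// unlock.
transitivity (\int[distribution P XYm]_z F z)%E.
  by rewrite integral_distribution.
rewrite (eq_measure_integral (muX \x muY)%E); last first.
  by move=> A mA _; exact/esym/prodE.
rewrite -integral12_prod_meas1//.
have iZ (Z : {RV P >-> R}) : P.-integrable [set: T] (EFin \o Z) ->
    (distribution P Z).-integrable [set: R] (EFin : R -> \bar R).
  by move=> ?; apply/integrableP; split=> //; exact: absX.
transitivity (\int[distribution P X]_x (x%:E * b%:E))%E; last first.
  by rewrite integralZr//; [rewrite (meanZ _ _ iX EX)|exact: iZ].
apply: eq_integral => x _.
transitivity (\int[distribution P Y]_y (x%:E * y%:E))%E; first by [].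
by rewrite integralZl//; [rewrite (meanZ _ _ iY EY)|exact: iZ].
Qed.

End Expectation.

(** * The sigma-algebra of the first [k] rates and its independence from the next rate *)

Definition past_rectangles (R : realType) (d : measure_display)
    (T : measurableType d) (P : probability T R) (X : nat -> {RV P >-> R})
    (k : nat) : set (set T) :=
  [set E | exists2 B : nat -> set R, forall l, measurable (B l) &
    E = [set w | forall l, (l < k)%N -> B l (X l.+1 w)]].

Section Past.
Context (R : realType) (d : measure_display) (T : measurableType d)
  (P : probability T R) (X : nat -> {RV P >-> R}).

Lemma past_rectanglesI k : setI_closed (past_rectangles X k).
Proof.
move=> _ _ [A mA ->] [B mB ->]; exists (fun l => A l `&` B l).
  by move=> l; exact: measurableI.
apply/seteqP; split=> w /=; first by move=> [wA wB] l lk; split; auto.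
by move=> wAB; split=> l lk; have [] := wAB l lk.
Qed.

(** This makes each of [X 1, ..., X k] measurable for the generated sigma-algebra. Rates are
    numbered from 1, so side [l] constrains [X l.+1]; all other sides are the whole line. *)
Lemma past_rectangles_preimage k l (B : set R) : (l < k)%N -> measurable B ->
  past_rectangles X k (X l.+1 @^-1` B).
Proof.
move=> lk mB; exists (fun q => if q == l then B else setT).
  by move=> q; case: ifP.
apply/seteqP; split=> w /=; last by move=> /(_ l lk); rewrite eqxx.
by move=> wB q qk; case: eqP => [->|].
Qed.

Lemma past_measurable k (E : set T) :
  <<s past_rectangles X k >> E -> measurable E.
Proof.
apply: smallest_sub; first exact: sigma_algebra_measurable.
move=> _ [B mB ->].
rewrite (_ : [set w | _] = \bigcap_(l < k) (X l.+1 @^-1` B l)) //.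
apply: bigcap_measurableType => l _.
by rewrite -[X in measurable X]setTI; exact: measurable_funP.
Qed.

(** For fixed [B], the events obeying the product rule form a Dynkin class. It contains the
    rectangles, which are closed under intersection, hence all of the sigma-algebra they
    generate. *)
Lemma past_independent n k (E : set T) (B : set R) :
  mutually_independent (fun l : 'I_n => X l.+1) -> (k < n)%N ->
  <<s past_rectangles X k >> E -> measurable B ->
  P (E `&` X k.+1 @^-1` B) = (P E * P (X k.+1 @^-1` B))%E.
Proof.
move=> Xind kn sE mB.
have mXB : measurable (X k.+1 @^-1` B).
  by rewrite -[X in measurable X]setTI; exact: measurable_funP.
have finG : P (X k.+1 @^-1` B) \is a fin_num by exact: fin_num_measure.
pose S := [set F : set T |
  P (F `&` X k.+1 @^-1` B) = (P F * P (X k.+1 @^-1` B))%E].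
apply: (@dynkin_induction _ (g_sigma_algebraType (past_rectangles X k))
  (past_rectangles X k) S) => //.
- exact: past_rectanglesI.
- by rewrite /S /= setTI probability_setT mul1e.
- move=> _ [A mA ->]; rewrite /S /=.
  (* [J] holds the [k] past indices and [A'] puts [B] at index [k]. Mutual independence is applied
     to [J] and to [J] enlarged by [k]; the two products differ by the factor at [k]. *)
  pose J := [set l : 'I_n | (l < k)%N]%SET.
  pose A' (l : 'I_n) := if (l < k)%N then A l else B.
  have mA' l : measurable (A' l) by rewrite /A'; case: ifP.
  have kJ : Ordinal kn \notin J by rewrite inE ltnn.
  have capJ : \bigcap_(l in [set` J]) (X l.+1 @^-1` A' l) =
      [set w | forall l, (l < k)%N -> A l (X l.+1 w)].
    apply/seteqP; split=> w /=.
    + move=> wA l lk; have := wA (Ordinal (ltn_trans lk kn)).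
      by rewrite /= /A' /= lk inE; exact.
    + by move=> wA l; rewrite /= inE => lk; rewrite /A' lk; exact: wA.
  have capkJ : \bigcap_(l in [set` Ordinal kn |: J]%SET) (X l.+1 @^-1` A' l) =
      [set w | forall l, (l < k)%N -> A l (X l.+1 w)] `&` X k.+1 @^-1` B.
    rewrite -capJ; apply/seteqP; split=> w /=.
    + move=> wA; split; first by move=> l lJ; apply: wA; rewrite /= inE lJ orbT.
      have := wA (Ordinal kn); rewrite /= /A' /= ltnn; apply.
      by rewrite /= !inE eqxx.
    + move=> [wA wB] l; rewrite /= in_setU1 => /orP[/eqP->|]; last exact: wA.
      by rewrite /A' /= ltnn.
  rewrite -capkJ Xind// big_setU1//= -Xind// capJ muleC.
  by rewrite /A' /= ltnn.
(* Complements: subtract the rule for [F] from the probability of the event of [B], which is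
   finite. *)
- move=> F mF; rewrite /S /= => FE.
  have mF' := past_measurable mF.
  rewrite setIC -setDE measureD//; last by rewrite ltey_eq finG.
  rewrite probability_setC// muleBl// ?mul1e ?fin_num_adde_defl//.
  by congr (_ - _)%E; rewrite setIC; exact: FE.
(* Disjoint unions: countable additivity on both sides, with the constant factor turned into a real
   number to pass through the series. *)
- move=> F mF tF FE; rewrite /S /=.
  have mF' q := past_measurable (mF q).
  rewrite setI_bigcupl !measure_bigcup//.
  + rewrite muleC -[P (X _ @^-1` _)]fineK// -nneseriesZl//.
    by apply: eq_eseriesr => q _; rewrite fineK// muleC; exact: FE.
  + by move=> q _; exact: measurableI.
  + exact: trivIset_setIr.
Qed.

Lemma past_independent2 n k (Z : T -> R) :
  mutually_independent (fun l : 'I_n => X l.+1) -> (k < n)%N ->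
  measurable_fun [set: g_sigma_algebraType (past_rectangles X k)] Z ->
  independent2 P Z (X k.+1).
Proof.
move=> Xind kn mZ A B mA mB; apply: (past_independent Xind) => //.
by have := mZ measurableT A mA; rewrite setTI.
Qed.

(** The dummy value 0 at [k = 0] makes the recursion uniform: the first payment joins an empty
    fund. *)
Lemma final_valueS (i c : nat -> R) k :
  final_value i c k.+1 = (1 + i k.+1) * (final_value i c k + c k.+1).
Proof. by case: k => [|k] //=; rewrite add0r. Qed.

Lemma final_value_past_measurable (c : nat -> R) k :
  measurable_fun [set: g_sigma_algebraType (past_rectangles X k)]
    (fun w => final_value (fun q => X q w) c k).
Proof.
(* The sigma-algebra stays fixed at [k] while the induction runs over [l]. *)
suff H l : (l <= k)%N ->
    measurable_fun [set: g_sigma_algebraType (past_rectangles X k)]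
      (fun w => final_value (fun q => X q w) c l) by exact: H.
elim: l => [_|l IH lk]; first exact: measurable_cst.
under eq_fun => w do rewrite final_valueS.
apply: measurable_funM; last first.
  by apply: measurable_funD; [exact: (IH (ltnW lk))|exact: measurable_cst].
apply: measurable_funD; first exact: measurable_cst.
move=> _ B mB; rewrite setTI.
by apply: sub_gen_smallest; exact: past_rectangles_preimage.
Qed.

Lemma final_value_measurable (c : nat -> R) k :
  measurable_fun [set: T] (fun w => final_value (fun q => X q w) c k).
Proof.
elim: k => [|k IH]; first exact: measurable_cst.
under eq_fun => w do rewrite final_valueS.
by apply: measurable_funM; apply: measurable_funD.
Qed.

End Past.

(** * Recursions and closed forms of the annuity sums *)

Section Due.
Context (R : comPzRingType).
Implicit Types (a : nat -> R) (x y : R).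

(** Each earlier payment gains one more factor [y] and the new one accrues once. Arbitrary weights
    [a] let this serve [Is_due], [I2s_due] and [cross_sum] alike. *)
Lemma sum_due_recr a y k :
  \sum_(1 <= l < k.+2) a l * y ^+ (k.+2 - l) =
  y * (\sum_(1 <= l < k.+1) a l * y ^+ (k.+1 - l) + a k.+1).
Proof.
rewrite big_nat_recr//= subSnn expr1 mulrDr (mulrC y (a _)); congr (_ + _).
rewrite big_distrr /=; apply: eq_big_nat => l /andP[_ lk].
by rewrite mulrCA -exprS -subSn// ltnW.
Qed.

Lemma Is_due0 x : Is_due 0 x = 0.
Proof. by rewrite /Is_due big_geq. Qed.

Lemma Is_dueS k x : Is_due k.+1 x = (1 + x) * (Is_due k x + k.+1%:R).
Proof. exact: (sum_due_recr (fun l => l%:R)). Qed.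

Lemma I2s_due0 x : I2s_due 0 x = 0.
Proof. by rewrite /I2s_due big_geq. Qed.

Lemma I2s_dueS k x : I2s_due k.+1 x = (1 + x) * (I2s_due k x + k.+1%:R ^+ 2).
Proof. exact: (sum_due_recr (fun l => l%:R ^+ 2)). Qed.

(* [M_2k] is [cross_sum k j m]. *)
Definition cross_sum k (x y : R) : R :=
  \sum_(1 <= l < k) l.+1%:R * y ^+ (k - l) * Is_due l x.

Lemma cross_sum0 x y : cross_sum 0 x y = 0.
Proof. by rewrite /cross_sum big_geq. Qed.

Lemma cross_sumS k x y :
  cross_sum k.+1 x y = y * (cross_sum k x y + k.+1%:R * Is_due k x).
Proof.
case: k => [|k]; first by rewrite /cross_sum !big_geq// Is_due0 mulr0 addr0 mulr0.
rewrite /cross_sum.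
(* Moving the power last exposes the weight [l.+1%:R * Is_due l x]. *)
under eq_bigr do rewrite mulrAC.
by rewrite sum_due_recr; under eq_bigr do rewrite mulrAC.
Qed.

End Due.

(** With the denominator [x ^+ 2] cleared, the induction step is a polynomial identity. *)
Lemma Is_due_closed (R : comPzRingType) k (x : R) :
  x ^+ 2 * Is_due k x = (1 + x) ^+ (k + 2) - (1 + x) - x * (1 + x) * k.+1%:R.
Proof.
elim: k => [|k IH]; first by rewrite Is_due0; ring.
rewrite Is_dueS mulrCA mulrDr IH addSn (exprS _ (k + 2)).
set y := (1 + x) ^+ (k + 2); ring.
Qed.

(** Since [(1 + j) * (1 + r) = 1 + f], all three terms on the right are multiplied by [1 + f] at
    each step, as [cross_sum] is. The added terms agree by the closed form of [Is_due k j]. *)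
Lemma cross_sum_closed (F : fieldType) k (j f r : F) :
  j != 0 -> 1 + j != 0 -> 1 + r = (1 + f) / (1 + j) ->
  cross_sum k j (1 + f) =
  ((1 + j) ^+ (k + 2) * Is_due k r - (1 + j) * Is_due k f
    - j * (1 + j) * I2s_due k f) / j ^+ 2.
Proof.
move=> j0 j1 rE; elim: k => [|k IH].
  by rewrite cross_sum0 !Is_due0 I2s_due0 !mulr0 !subr0 mul0r.
have D : Is_due k j =
    ((1 + j) ^+ (k + 2) - (1 + j) - j * (1 + j) * k.+1%:R) / j ^+ 2.
  by rewrite -Is_due_closed mulrC mulKf// expf_neq0.
rewrite cross_sumS IH D !Is_dueS I2s_dueS rE.
rewrite addSn (exprS _ (k + 2)).
set y := (1 + j) ^+ (k + 2); set c := k.+1%:R; field; exact/andP.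
Qed.

(** * First and second moments of the final value *)

Section Moments.
Context (R : realType) (d : measure_display) (T : measurableType d)
  (P : probability T R).

(** The finite variance makes [(X - a) ^+ 2] integrable; then
    [X ^+ 2 = (X - a) ^+ 2 + 2 a X - a ^+ 2] is integrated term by term. *)
Lemma has_expectation_sqr (X : T -> R) (a s : R) : measurable_fun [set: T] X ->
  ('E_P[X] = a%:E)%E -> ('V_P[X] = (s ^+ 2)%:E)%E ->
  has_expectation P (fun w => X w ^+ 2) (a ^+ 2 + s ^+ 2).
Proof.
move=> mX EX VX.
have hX := fin_has_expectation mX EX.
have mD : measurable_fun [set: T] (fun w => (X w - a) ^+ 2).
  by apply: measurable_funX; exact: measurable_funB.
have hD : has_expectation P (fun w => (X w - a) ^+ 2) (s ^+ 2).
  apply: fin_has_expectation => //; rewrite -VX /variance covariance.unlock EX /=.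
  by congr ('E_P[_])%E; apply/funext => w /=; rewrite expr2.
have := has_expectationD hD (has_expectationD (has_expectationZ (2 * a) hX)
  (has_expectation_cst P (- a ^+ 2))).
have -> : s ^+ 2 + (2 * a * a + - a ^+ 2) = a ^+ 2 + s ^+ 2 by ring.
by congr has_expectation; apply/funext => w; ring.
Qed.

Variables (n : nat) (i : nat -> {RV P >-> R}) (j s : R).
Hypothesis i_indep : mutually_independent (fun l : 'I_n => i l.+1).
Hypothesis i_mean : forall l : nat, (1 <= l <= n)%N ->
  ('E_P[fun w => (1 + i l w)%R] = (1 + j)%:E)%E.
Hypothesis i_var : forall l : nat, (1 <= l <= n)%N ->
  ('V_P[fun w => (1 + i l w)%R] = (s ^+ 2)%:E)%E.

Let C k w := increasing_final_value (fun q => i q w) k.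
Let m := (1 + j) ^+ 2 + s ^+ 2.

(** Both moments go through one induction because the second-moment recursion involves the mean. [m]
    is the second moment of [1 + i l], and [m - 1] is the corresponding rate. *)
Lemma increasing_final_value_moments k : (k <= n)%N ->
  has_expectation P (C k) (Is_due k j) /\
  has_expectation P (fun w => C k w ^+ 2)
    (I2s_due k (m - 1) + 2 * cross_sum k j m).
Proof.
elim: k => [_|k IH kn].
  rewrite Is_due0 I2s_due0 cross_sum0 mulr0 addr0 /C /=; split.
    exact: has_expectation_cst.
  under eq_fun do rewrite expr0n /=.
  exact: has_expectation_cst.
have [hC hC2] := IH (ltnW kn).
have mC : measurable_fun [set: T] (C k) by exact: final_value_measurable.
have mi : measurable_fun [set: T] (fun w => 1 + i k.+1 w).
  exact: measurable_funD.
have hk : (1 <= k.+1 <= n)%N by [].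
have hi := fin_has_expectation mi (i_mean hk).
have hi2 := has_expectation_sqr mi (i_mean hk) (i_var hk).
(* Independence of [C k] and the next rate; composing with measurable maps gives it for the factors
   of [C k.+1] and for their squares. *)
have ind := past_independent2 i_indep kn
  (final_value_past_measurable (X := i) (fun l => l%:R) (k := k)).
pose cS : R := k.+1%:R.
have hCc := has_expectationD hC (has_expectation_cst P cS).
have mCc : measurable_fun [set: T] (fun w => C k w + cS).
  exact: measurable_funD.
split.
- pose Y : {RV P >-> R} := mfun_Sub (mem_set mCc).
  pose V : {RV P >-> R} := mfun_Sub (mem_set mi).
  have YV : independent2 P Y V.
    apply: (independent2_comp (g := fun x => x + cS) (h := fun x => 1 + x)) ind;
      exact: measurable_funD.
  have := has_expectationM YV hCc hi.
  rewrite Is_dueS mulrC; congr has_expectation; apply/funext => w.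
  by rewrite /C /increasing_final_value final_valueS mulrC.
- have mY2 : measurable_fun [set: T] (fun w => (C k w + cS) ^+ 2).
    exact: measurable_funX.
  have mV2 : measurable_fun [set: T] (fun w => (1 + i k.+1 w) ^+ 2).
    exact: measurable_funX.
  pose Y : {RV P >-> R} := mfun_Sub (mem_set mY2).
  pose V : {RV P >-> R} := mfun_Sub (mem_set mV2).
  have YV : independent2 P Y V.
    apply: (independent2_comp (g := fun x => (x + cS) ^+ 2)
      (h := fun x => (1 + x) ^+ 2)) ind;
      by apply: measurable_funX; exact: measurable_funD.
  have hY : has_expectation P Y (I2s_due k (m - 1) + 2 * cross_sum k j m
      + (2 * cS * Is_due k j + cS ^+ 2)).
    have := has_expectationD hC2 (has_expectationD
      (has_expectationZ (2 * cS) hC) (has_expectation_cst P (cS ^+ 2))).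
    by congr has_expectation; apply/funext => w /=; ring.
  have := has_expectationM YV hY hi2.
  (* Of the expanded square, [cS ^+ 2] feeds [I2s_due] and [2 * cS * Is_due k j] feeds twice the
     [cross_sum]. *)
  rewrite I2s_dueS cross_sumS -/m -/cS.
  have -> : 1 + (m - 1) = m by rewrite addrC subrK.
  congr has_expectation; last by ring.
  apply/funext => w.
  by rewrite /C /increasing_final_value final_valueS /= exprMn mulrC.
Qed.

End Moments.

Theorem corollary3p2 (R : realType) (d : measure_display)
    (T : measurableType d) (P : probability T R)
    (n : nat) (i : nat -> {RV P >-> R}) (j s f r m : R) (k : nat)
    (n_ge1 : (1 <= n)%N)
    (i_indep : mutually_independent (fun l : 'I_n => i l.+1))
    (i_mean : forall l : nat, (1 <= l <= n)%N ->
      ('E_P[fun w => (1 + i l w)%R] = (1 + j)%:E)%E)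
    (i_var : forall l : nat, (1 <= l <= n)%N ->
      ('V_P[fun w => (1 + i l w)%R] = (s ^+ 2)%:E)%E)
    (j_neq0 : j != 0) (j_neqN1 : j != -1)
    (fE : f = 2 * j + j ^+ 2 + s ^+ 2)
    (rE : 1 + r = (1 + f) / (1 + j))
    (mE : m = 1 + f)
    (k_range : (1 <= k <= n)%N) :
  let C := fun (l : nat) (w : T) => increasing_final_value (fun q => i q w) l in
  let mu := fun l : nat => ('E_P[C l])%E in
  let m_ := fun l : nat => ('E_P[fun w => (C l w ^+ 2)%R])%E in
  let M1 := \sum_(1 <= l < k.+1) l%:R ^+ 2 * m ^+ (k.+1 - l) in
  let M2 := (\sum_(1 <= l < k) (l.+1%:R * m ^+ (k - l))%:E * mu l)%E in
  [/\ mu k = (Is_due k j)%:E,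
      M1 = I2s_due k f,
      M2 = (((1 + j) ^+ (k + 2) * Is_due k r - (1 + j) * Is_due k f
             - j * (1 + j) * I2s_due k f) / j ^+ 2)%:E
    & m_ k = ((2 * (1 + j) ^+ (k + 2) * Is_due k r - 2 * (1 + j) * Is_due k f
               - j * (2 + j) * I2s_due k f) / j ^+ 2)%:E].
Proof.
move=> C mu m_ M1 M2.
have j1 : 1 + j != 0 by rewrite addrC addr_eq0.
have mjs : m = (1 + j) ^+ 2 + s ^+ 2 by rewrite mE fE; ring.
have fm : f = m - 1 by rewrite mE addrC addKr.
have moments l : (l <= n)%N -> has_expectation P (C l) (Is_due l j) /\
    has_expectation P (fun w => C l w ^+ 2)
      (I2s_due l f + 2 * cross_sum l j (1 + f)).
  rewrite -mE fm mjs; exact: increasing_final_value_moments.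
have /andP[_ kn] := k_range.
split.
- by have [[_ muE] _] := moments k kn.
- by rewrite /M1 mE.
(* [M2] is an extended-real sum; part (a) at every [l < k] turns its terms into reals. *)
- rewrite -cross_sum_closed// /M2 /cross_sum -mE -sumEFin.
  apply: eq_big_nat => l /andP[_ lk].
  by have [[_ muE] _] := moments l (leq_trans (ltnW lk) kn); rewrite /mu muE.
- have [_ [_ mkE]] := moments k kn.
  (* In [M1 + 2 M2] the coefficient of [I2s_due k f] over [j ^+ 2] is
     [j^2 - 2 j (1 + j) = - j (2 + j)]. *)
  rewrite /m_ mkE (cross_sum_closed k j_neq0 j1 rE); congr (_%:E).
  by field.
Qed.
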